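(* Let $G$ be a profinite group and let $(L,\eta)$ be an envelope of $G$. Then there exists a canonical continuous open homomorphism $\eta_*:L\to\mathrm{Comm}(G)_S$ such that $\eta_*\circ\eta=\iota_G$ (identifying $G$ with $\eta(G)$, the element $\eta_*(l)$ is the class of the virtual automorphism $x\mapsto lxl^{-1}$ from $G\cap l^{-1}Gl$ to $lGl^{-1}\cap G$). The kernel of $\eta_*$ is equal to $\mathrm{VZ}(L)$. Furthermore, if $\mathrm{VZ}(G)=\{1\}$, then $\eta_*$ is the unique homomorphism $L\to\mathrm{Comm}(G)_S$ with $\eta_*\circ\eta=\iota_G$.
   Context: For a topological group $L$, the virtual center is $\mathrm{VZ}(L)=\{g\in L: \text{the centralizer of } g \text{ in } L \text{ is open in } L\}$. Commensurator of a profinite group $G$: a virtual automorphism of $G$ is a topological isomorphism between two open subgroups of $G$; two are equivalent if they coincide on some open subgroup; the equivalence classes $[\phi]$ form, under composition (after restricting to suitable open subgroups), a group $\mathrm{Comm}(G)$. For an open subgroup $U$ of $G$, $\iota_U:U\to\mathrm{Comm}(G)$ sends $g$ to the class of the automorphism $x\mapsto gxg^{-1}$ of $U$. $\mathrm{Comm}(G)_S$ denotes $\mathrm{Comm}(G)$ with the strong topology: the unique group topology (not necessarily Hausdorff) for which $\{\iota_U(U): U \text{ open subgroup of } G\}$ is a base of neighborhoods of $1$. An envelope of a profinite group $G$ is a pair $(L,\eta)$ where $L$ is a topological group and $\eta:G\to L$ is an injective homomorphism such that $\eta(G)$ is open in $L$ and $\eta$ is a homeomorphism onto $\eta(G)$.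 *)

(* Defs.v *)
From HB Require Import structures.
From mathcomp Require Import all_boot.
From mathcomp Require Import generic_quotient.
From mathcomp Require Import boolp classical_sets functions filter topology.

Set Implicit Arguments.
Unset Strict Implicit.
Unset Printing Implicit Defensive.

Local Open Scope quotient_scope.
Local Open Scope classical_set_scope.
Local Open Scope group_scope.

HB.mixin Record isTopologicalGroup G & Topological G & Group G := {
  mulg_continuous : continuous (fun x : G * G => x.1 * x.2);
  invg_continuous : continuous (fun x : G => x^-1)
}.

#[short(type="topGroupType")]
HB.structure Definition TopologicalGroup :=
  {G of Topological G & Group G & isTopologicalGroup G}.

Definition profinite (G : topGroupType) :=
  [/\ compact [set: G], hausdorff_space G & totally_disconnected [set: G]].

Definition virtual_center (L : topGroupType) : set L :=
  [set g | open [set x : L | commute g x]].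
Arguments virtual_center L : clear implicits.

Definition open_map (X Y : topologicalType) (f : X -> Y) :=
  forall A : set X, open A -> open (f @` A).

Definition envelope (G L : topGroupType) (eta : {multiplicative G -> L}) :=
  [/\ injective eta,
      open (range eta),
      continuous eta
    & exists2 eta' : L -> G, cancel eta eta'
                           & {within range eta, continuous eta'}].

Record open_subgroup (G : topGroupType) := OpenSubgroup {
  osg :> G -> Prop;
  osg_open : open (osg : set G);
  osg1 : osg 1;
  osgM : forall x y, osg x -> osg y -> osg (x * y);
  osgV : forall x, osg x -> osg x^-1
}.

Section TopGroupTheory.
Variable G : topGroupType.
Implicit Types x y g : G.

Lemma mulgl_continuous g : continuous (fun x => g * x).
Proof.
move=> x; apply: (@continuous_comp _ _ _ (fun x => (g, x))
  (fun x : G * G => x.1 * x.2)); last exact: mulg_continuous.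
by apply: cvg_pair => //=; exact: cvg_cst.
Qed.

Lemma mulgr_continuous g : continuous (fun x => x * g).
Proof.
move=> x; apply: (@continuous_comp _ _ _ (fun x => (x, g))
  (fun x : G * G => x.1 * x.2)); last exact: mulg_continuous.
by apply: cvg_pair => //=; exact: cvg_cst.
Qed.

Lemma conj_continuous g : continuous (fun x => g * x * g^-1).
Proof.
move=> x; apply: (@continuous_comp _ _ _ (fun x => g * x)
  (fun x => x * g^-1)); [exact: mulgl_continuous | exact: mulgr_continuous].
Qed.

Definition osgT : open_subgroup G :=
  OpenSubgroup (@openT G) I (fun _ _ _ _ => I) (fun _ _ => I).

Program Definition osgI (U V : open_subgroup G) : open_subgroup G :=
  @OpenSubgroup G (osg U `&` osg V) _ _ _ _.
Next Obligation. by move=> U V; apply: openI; exact: osg_open. Qed.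
Next Obligation. by move=> U V; split; exact: osg1. Qed.
Next Obligation.
by move=> U V x y [Ux Vx] [Uy Vy]; split; exact: osgM.
Qed.
Next Obligation. by move=> U V x [Ux Vx]; split; exact: osgV. Qed.

Program Definition osgJ (U : open_subgroup G) g : open_subgroup G :=
  @OpenSubgroup G (fun x => U (g^-1 * x * g)) _ _ _ _.
Next Obligation.
move=> U g; have := @conj_continuous g^-1; rewrite invgK => /continuousP.
by apply; exact: osg_open.
Qed.
Next Obligation. by move=> U g; rewrite /= mulg1 mulVg; exact: osg1. Qed.
Next Obligation.
move=> U g x y /= Ux Uy.
suff -> : g^-1 * (x * y) * g = g^-1 * x * g * (g^-1 * y * g) by exact: osgM.
by rewrite !mulgA mulgK.
Qed.
Next Obligation.
move=> U g x /= Ux.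
suff -> : g^-1 * x^-1 * g = (g^-1 * x * g)^-1 by exact: osgV.
by rewrite !invgM invgK mulgA.
Qed.

(* The functions are total on G, but only their values on vdom (resp. vcod)   *)
(* matter: two representations that differ elsewhere are equivalent below.    *)
Record virtual_aut := VirtualAut {
  vdom : open_subgroup G;
  vcod : open_subgroup G;
  vfun :> G -> G;
  vinv : G -> G;
  vfunP : forall x, vdom x -> vcod (vfun x);
  vinvP : forall y, vcod y -> vdom (vinv y);
  vfunK : forall x, vdom x -> vinv (vfun x) = x;
  vinvK : forall y, vcod y -> vfun (vinv y) = y;
  vfunM : forall x y, vdom x -> vdom y -> vfun (x * y) = vfun x * vfun y;
  vfun_continuous : {within osg vdom, continuous vfun};
  vinv_continuous : {within osg vcod, continuous vinv}
}.
Implicit Types f h k : virtual_aut.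

HB.instance Definition _ := gen_eqMixin virtual_aut.
HB.instance Definition _ := gen_choiceMixin virtual_aut.

Definition vequiv f h :=
  exists W : open_subgroup G,
    [/\ osg W `<=` vdom f, osg W `<=` vdom h & forall x, W x -> f x = h x].

Definition vequivb : rel virtual_aut := fun f h => `[< vequiv f h >].

Lemma vequiv_is_equiv : equiv_class_of vequivb.
Proof.
split.
- by move=> f; apply/asboolP; exists (vdom f); split.
- move=> f h; apply/asboolP/asboolP => -[W [W1 W2 E]]; exists W.
  + by split=> // x Wx; rewrite E.
  + by split=> // x Wx; rewrite E.
- move=> h f k /asboolP[W [Wf Wh E]] /asboolP[W' [W'h W'k E']].
  apply/asboolP; exists (osgI W W'); split.
  + by move=> x [/Wf].
  + by move=> x [_ /W'k].
  + by move=> x [Wx W'x]; rewrite E// E'.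
Qed.

Canonical vequiv_equiv := EquivRelPack vequiv_is_equiv.

Definition Comm := {eq_quot vequiv_equiv}.

HB.instance Definition _ := Choice.on Comm.
HB.instance Definition _ := Quotient.on Comm.

Definition vclass f : Comm := \pi_Comm f.

Lemma vclassE f h : vclass f = vclass h <-> vequiv f h.
Proof. by split=> [/eqquotP/asboolP|fh] //; apply/eqquotP/asboolP. Qed.

Lemma vclassP (c : Comm) : exists f, c = vclass f.
Proof. by exists (repr c); rewrite /vclass reprK. Qed.

Lemma vfun1 f : f 1 = 1.
Proof.
have := @vfunM f 1 1 (osg1 _) (osg1 _).
by rewrite mulg1 => /(congr1 ( *%g (f 1)^-1)); rewrite mulKg mulVg => <-.
Qed.

Lemma vfunV f x : vdom f x -> f x^-1 = (f x)^-1.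
Proof.
move=> fx; have := @vfunM f x x^-1 fx (osgV fx).
by rewrite mulgV vfun1 => /(congr1 ( *%g (f x)^-1)); rewrite mulKg mulg1.
Qed.

Program Definition vinverse f : virtual_aut :=
  @VirtualAut (vcod f) (vdom f) (vinv f) f
    (@vinvP f) (@vfunP f) (@vinvK f) (@vfunK f) _
    (@vinv_continuous f) (@vfun_continuous f).
Next Obligation.
move=> f x y fx fy; rewrite -[x in LHS](vinvK fx) -[y in LHS](vinvK fy).
by rewrite -vfunM ?vfunK//; [apply: osgM|..]; exact: vinvP.
Qed.

Program Definition vpreim f (V : open_subgroup G) : open_subgroup G :=
  @OpenSubgroup G (osg (vdom f) `&` f @^-1` osg V) _ _ _ _.
Next Obligation.
move=> f V; rewrite openE => x [/= fx Vx].
have fo := @osg_open _ (vdom f).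
apply: filterI; first exact: open_nbhs_nbhs.
have := @vfun_continuous f.
rewrite continuous_open_subspace// => /(_ x (mem_set fx)); apply.
by apply: open_nbhs_nbhs; split => //; exact: osg_open.
Qed.
Next Obligation. by move=> f V; split=> /=; rewrite ?vfun1; exact: osg1. Qed.
Next Obligation.
by move=> f V x y [/= fx Vx] [fy Vy]; split=> /=; rewrite ?vfunM//; exact: osgM.
Qed.
Next Obligation.
by move=> f V x [/= fx Vx]; split=> /=; rewrite ?vfunV//; exact: osgV.
Qed.

Lemma vcomp_continuous f h :
  {within osg (vpreim h (vdom f)), continuous (f \o h)}.
Proof.
have := @osg_open _ (vpreim h (vdom f)) => o.
rewrite continuous_open_subspace// => x /set_mem[/= hx fhx].
apply: continuous_comp.
- have := @vfun_continuous h.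
  rewrite continuous_open_subspace; last exact: osg_open.
  by apply; rewrite inE.
- have := @vfun_continuous f.
  rewrite continuous_open_subspace; last exact: osg_open.
  by apply; rewrite inE.
Qed.

Program Definition vcomp f h : virtual_aut :=
  @VirtualAut (vpreim h (vdom f)) (vpreim (vinverse f) (vcod h))
    (f \o h) (vinv h \o vinv f) _ _ _ _ _ (@vcomp_continuous f h)
    (@vcomp_continuous (vinverse h) (vinverse f)).
Next Obligation.
move=> f h x [/= hx fhx]; split => /=; first exact: vfunP.
by rewrite vfunK//; exact: vfunP.
Qed.
Next Obligation.
move=> f h x [/= hx fhx]; split => /=; first exact: vinvP.
by rewrite vinvK//; exact: vinvP.
Qed.
Next Obligation. by move=> f h x [/= hx fhx]; rewrite !vfunK. Qed.
Next Obligation. by move=> f h x [/= hx fhx]; rewrite !vinvK. Qed.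
Next Obligation.
by move=> f h x y [/= hx fhx] [/= hy fhy]; rewrite !vfunM.
Qed.

(* For g in U, this is the automorphism x |-> g x g^-1 of U (vconj_cod).      *)
Program Definition vconj (U : open_subgroup G) g : virtual_aut :=
  @VirtualAut U (osgJ U g) (fun x => g * x * g^-1) (fun x => g^-1 * x * g)
    _ _ _ _ _ _ _.
Next Obligation. by move=> U g x Ux; rewrite /= !mulgA mulVg mul1g mulgVK. Qed.
Next Obligation. by []. Qed.
Next Obligation. by move=> U g x Ux; rewrite /= !mulgA mulVg mul1g mulgVK. Qed.
Next Obligation. by move=> U g x Ux; rewrite /= !mulgA mulgV mul1g mulgK. Qed.
Next Obligation. by move=> U g x y Ux Uy; rewrite /= !mulgA mulgVK. Qed.
Next Obligation.
by move=> U g; apply: continuous_subspaceT; exact: conj_continuous.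
Qed.
Next Obligation.
move=> U g; apply: continuous_subspaceT.
by have := @conj_continuous g^-1; rewrite invgK.
Qed.

Lemma vconj_cod (U : open_subgroup G) g :
  U g -> vcod (vconj U g) = U :> (G -> Prop).
Proof.
move=> Ug; apply/seteqP; split=> x /= Ux.
  have -> : x = g * (g^-1 * x * g) * g^-1 by rewrite !mulgA mulgV mul1g mulgK.
  by apply: osgM; [apply: osgM|apply: osgV].
by apply: osgM => //; apply: osgM => //; apply: osgV.
Qed.

Definition comm_iota (U : open_subgroup G) g : Comm := vclass (vconj U g).

Definition comm_one : Comm := comm_iota osgT 1.
Definition comm_mul (a b : Comm) : Comm := vclass (vcomp (repr a) (repr b)).
Definition comm_inv (a : Comm) : Comm := vclass (vinverse (repr a)).

Lemma vrepr f : vequiv (repr (vclass f)) f.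
Proof. by apply/vclassE; rewrite /vclass reprK. Qed.

Lemma comm_mulE f h : comm_mul (vclass f) (vclass h) = vclass (vcomp f h).
Proof.
apply/vclassE; have [W [W1 W2 E]] := vrepr f; have [V [V1 V2 E']] := vrepr h.
exists (osgI V (vpreim h W)); split.
- by move=> x [Vx [/= hx Wx]]; split; [exact: V1|rewrite /= E'//; exact: W1].
- by move=> x [Vx [/= hx Wx]]; split=> //=; exact: W2.
- by move=> x [Vx [/= hx Wx]]; rewrite E'// E.
Qed.

Lemma comm_invE f : comm_inv (vclass f) = vclass (vinverse f).
Proof.
apply/vclassE; have [W [W1 W2 E]] := vrepr f.
exists (vpreim (vinverse f) W); split.
- move=> y [/= fy Wy]; rewrite -[y](vinvK fy) -E//.
  by apply: vfunP; exact: W1.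
- by move=> y [/= fy Wy].
- move=> y [/= fy Wy]; rewrite -{1}[y](vinvK fy) -E//.
  by rewrite vfunK//; exact: W1.
Qed.

Lemma comm_mulA : associative comm_mul.
Proof.
move=> a b c; have [f ->] := vclassP a; have [h ->] := vclassP b.
have [k ->] := vclassP c; rewrite !comm_mulE; apply/vclassE.
exists (vdom (vcomp f (vcomp h k))); split => //.
by move=> x [[/= kx hkx] /= fx].
Qed.

Lemma comm_mul1 : left_id comm_one comm_mul.
Proof.
move=> a; have [f ->] := vclassP a; rewrite comm_mulE; apply/vclassE.
exists (vdom f); split => //.
by move=> x fx; rewrite /= mul1g invg1 mulg1.
Qed.

Lemma comm_1mul : right_id comm_one comm_mul.
Proof.
move=> a; have [f ->] := vclassP a; rewrite comm_mulE; apply/vclassE.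
exists (vdom f); split => //.
  by move=> x fx; split => //=; rewrite mul1g invg1 mulg1.
by move=> x fx; rewrite /= mul1g invg1 mulg1.
Qed.

Lemma comm_mulV : left_inverse comm_one comm_inv comm_mul.
Proof.
move=> a; have [f ->] := vclassP a; rewrite comm_invE comm_mulE.
apply/vclassE; exists (vdom f); split => //.
  by move=> x fx; split => //=; exact: vfunP.
by move=> x fx; rewrite /= mul1g invg1 mulg1 vfunK.
Qed.

Lemma comm_Vmul : right_inverse comm_one comm_inv comm_mul.
Proof.
move=> a; have [f ->] := vclassP a; rewrite comm_invE comm_mulE.
apply/vclassE; exists (vcod f); split => //.
  by move=> x fx; split => //=; exact: vinvP.
by move=> x fx; rewrite /= mul1g invg1 mulg1 vinvK.
Qed.

HB.instance Definition _ := isGroup.Build Comm comm_mulA comm_mul1 comm_1mul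
  comm_mulV comm_Vmul.

Lemma vclassM f h : vclass f * vclass h = vclass (vcomp f h).
Proof. exact: comm_mulE. Qed.

Lemma vclassV f : (vclass f)^-1 = vclass (vinverse f).
Proof. exact: comm_invE. Qed.

Lemma comm_iota_eq (U V : open_subgroup G) g : comm_iota U g = comm_iota V g.
Proof. by apply/vclassE; exists (osgI U V); split=> // x []. Qed.

Lemma comm_iotaM (U : open_subgroup G) x y :
  comm_iota U (x * y) = comm_iota U x * comm_iota U y.
Proof.
rewrite (comm_iota_eq U osgT x) vclassM; apply/vclassE; exists U; split => //.
by move=> z Uz; rewrite /= invgM !mulgA.
Qed.

Lemma comm_iota1 (U : open_subgroup G) : comm_iota U 1 = 1.
Proof. exact: comm_iota_eq. Qed.

Lemma comm_iotaV (U : open_subgroup G) g :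
  comm_iota U g^-1 = (comm_iota U g)^-1.
Proof.
have := comm_iotaM U g g^-1; rewrite mulgV comm_iota1 => E.
by rewrite -[RHS]mulg1 E mulKg.
Qed.

Lemma comm_iota_conj (U : open_subgroup G) f g : vdom f g ->
  vclass f * comm_iota U g = comm_iota U (f g) * vclass f.
Proof.
move=> fg; rewrite (comm_iota_eq U osgT g) (comm_iota_eq U osgT (f g)) !vclassM.
have fV := osgV fg; apply/vclassE; exists (vdom f); split => //.
  by move=> x fx; split => //=; apply: osgM => //; exact: osgM.
by move=> x fx; rewrite /= !vfunM ?vfunV//; exact: osgM.
Qed.

(* The strong topology: the neighborhoods of c are the supersets of the       *)
(* translates c * comm_iota U @` osg U.                                       *)
Definition strong_nbhs (c : Comm) : set_system Comm :=
  [set A | exists U : open_subgroup G, forall g, U g -> A (c * comm_iota U g)].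

HB.instance Definition _ := hasNbhs.Build Comm strong_nbhs.

Lemma strong_nbhs_filter (c : Comm) : ProperFilter (nbhs c).
Proof.
split.
  by case=> U /(_ 1 (osg1 U)).
split.
- by exists osgT.
- move=> A B [U UA] [V VB]; exists (osgI U V) => g [Ug Vg].
  split; first by rewrite (comm_iota_eq _ U); exact: UA.
  by rewrite (comm_iota_eq _ V); exact: VB.
- by move=> A B AB [U UA]; exists U => g /UA /AB.
Qed.

Lemma strong_nbhs_singleton (c : Comm) (A : set Comm) : nbhs c A -> A c.
Proof. by case=> U /(_ 1 (osg1 U)); rewrite comm_iota1 mulg1. Qed.

Lemma strong_nbhs_nbhs (c : Comm) (A : set Comm) :
  nbhs c A -> nbhs c (nbhs^~ A).
Proof.
case=> U UA; exists U => g Ug; exists U => h Uh.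
by rewrite -mulgA -comm_iotaM; apply: UA; exact: osgM.
Qed.

HB.instance Definition _ := Nbhs_isNbhsTopological.Build Comm
  strong_nbhs_filter strong_nbhs_singleton strong_nbhs_nbhs.

Lemma strong_nbhsE (c : Comm) (A : set Comm) :
  nbhs c A <->
    exists U : open_subgroup G, forall g, U g -> A (c * comm_iota U g).
Proof. by []. Qed.

Lemma comm_iota_conjV (U : open_subgroup G) f g :
  vdom f (vinv f g) -> vcod f g ->
  comm_iota U g * vclass f = vclass f * comm_iota U (vinv f g).
Proof. by move=> fg cg; rewrite comm_iota_conj// vinvK. Qed.

Lemma strong_mulg_continuous : continuous (fun x : Comm * Comm => x.1 * x.2).
Proof.
move=> [a b] A /= [U UA]; have [f fb] := vclassP b.
exists ([set a * comm_iota osgT g | g in osg (vpreim (vinverse f) U)],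
        [set b * comm_iota osgT g | g in osg U]).
  split => /=.
    exists (vpreim (vinverse f) U) => g Ug.
    by exists g => //; rewrite (comm_iota_eq _ osgT).
  by exists U => g Ug; exists g => //; rewrite (comm_iota_eq _ osgT).
move=> [_ _] /= [[g [/= cg Ug] <-] [h Uh <-]] /=.
rewrite !(comm_iota_eq osgT U) -[_ * (b * _)]mulgA [comm_iota U g * _]mulgA.
rewrite fb comm_iota_conjV//; last exact: vinvP.
rewrite -fb -[b * _ * _]mulgA -comm_iotaM mulgA.
by apply: UA; exact: osgM.
Qed.

Lemma strong_invg_continuous : continuous (fun x : Comm => x^-1).
Proof.
move=> a A /= [U UA]; have [f fa] := vclassP a.
exists (vpreim f U) => g [/= fg Ug].
rewrite (comm_iota_eq _ U) /= fa comm_iota_conj// invgM -comm_iotaV -fa.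
by apply: UA; exact: osgV.
Qed.

HB.instance Definition _ :=
  isTopologicalGroup.Build Comm strong_mulg_continuous strong_invg_continuous.

Lemma strong_nbhs1P (A : set Comm) :
  nbhs (1 : Comm) A <-> exists U : open_subgroup G, comm_iota U @` osg U `<=` A.
Proof.
split=> -[U UA]; exists U.
  by move=> _ [g Ug <-]; have := UA g Ug; rewrite mul1g.
by move=> g Ug; rewrite mul1g; apply: UA; exists g.
Qed.

End TopGroupTheory.

Arguments osgT {G}.
Arguments vclass {G}.

(* f is x |-> l x l^-1 from G :&: l^-1 G l to l G l^-1 :&: G, where G is      *)
(* identified with eta G.                                                     *)
Definition envelope_conj (G L : topGroupType) (eta : G -> L) (l : L)
    (f : virtual_aut G) :=
  [/\ forall x, vdom f x <-> range eta (l * eta x * l^-1),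
      forall y, vcod f y <-> range eta (l^-1 * eta y * l)
    & forall x, vdom f x -> eta (f x) = l * eta x * l^-1].

(* Main.v *)
Require Import Defs.
From HB Require Import structures.
From mathcomp Require Import all_boot.
From mathcomp Require Import boolp classical_sets functions filter topology.

(* Conjugation by l restricts to a virtual automorphism of the open subgroup  *)
(* G of L, and l |-> [conjugation by l] is the required map. It kills l       *)
(* exactly when l centralizes a neighborhood of 1. It maps l * U to           *)
(* etas l * iota U for U an open subgroup of G, and these translates are      *)
(* bases of neighborhoods on both sides: on the side of L by van Dantzig's    *)
(* theorem. If psi is another extension of iota, then etas l and psi l        *)
(* conjugate iota x in the same way for x in an open subgroup of G, and the   *)
(* image of an open subgroup has trivial centralizer in Comm(G) as soon as    *)
(* VZ(G) = 1, since f iota(x) f^-1 = iota(f x) and iota is injective.         *)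

Set Implicit Arguments.
Unset Strict Implicit.
Unset Printing Implicit Defensive.

Local Open Scope classical_set_scope.
Local Open Scope group_scope.

(** * Van Dantzig's theorem: open subgroups form a neighborhood base of 1 in a profinite group *)

(* Otherwise the sets D `\` U, for D clopen containing x, form a filter base  *)
(* on the compact set ~` U; no y outside U is a cluster point of it.          *)
Lemma compact_clopen_sub (T : topologicalType) (x : T) (U : set T) :
  compact [set: T] -> open U ->
  (forall y, ~ U y -> exists D : set T, [/\ clopen D, D x & ~ D y]) ->
  exists D : set T, [/\ clopen D, D x & D `<=` U].
Proof.
move=> cT oU sepU; apply: contrapT => nD.
pose F := filter_from [set D : set T | clopen D /\ D x] (fun D => D `\` U).
have FP : ProperFilter F.
  apply: filter_from_proper.
    apply: filter_from_filter; first by exists setT; split => //; exact: clopenT.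
    move=> A B [cA Ax] [cB Bx]; exists (A `&` B).
      by split => //; exact: clopenI.
    by move=> z [[]].
  move=> D [cD Dx]; apply: contrapT => D0; apply: nD; exists D; split => // y Dy.
  by apply: contrapT => nUy; apply: D0; exists y.
have [||y [nUy Fy]] := subclosed_compact (open_closedC oU) cT _ FP => //.
  by exists setT; [split => //; exact: clopenT|move=> y []].
have [D [cD Dx nDy]] := sepU y nUy.
have [||z [[Dz _] /(_ Dz)//]] := Fy (D `\` U) (~` D).
  by exists D.
by apply: open_nbhs_nbhs; split => //; apply: closed_openC; case: cD.
Qed.

(* The intersection Q of the clopen sets containing x is connected: normality *)
(* separates a relatively clopen B in Q from Q `\` B by open sets, whose      *)
(* union contains a clopen D around x; then D meets each of them in a clopen  *)
(* set, and the one that contains x contains all of Q.                        *)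
Lemma totally_disconnected_zero_dimensional (T : topologicalType) :
  compact [set: T] -> hausdorff_space T -> totally_disconnected [set: T] ->
  zero_dimensional T.
Proof.
move=> cT hT tdT x y /eqP xy; apply: contrapT => nsep.
pose Q := [set z | forall D : set T, clopen D -> D x -> D z].
have Qx : Q x by [].
have Qy : Q y.
  move=> D cD Dx; apply: contrapT => nDy; apply: nsep.
  by exists D; split.
apply: xy; suff : [set x] y by move=> ->.
rewrite -(tdT x I); exists Q => //; split => //.
have cQ : closed Q.
  rewrite [Q](_ : _ = \bigcap_(D in [set D | clopen D /\ D x]) D); last first.
    by apply/seteqP; split=> z Qz D; [move=> [*]|move=> *]; exact: Qz.
  by apply: closed_bigI => D [[]].
move=> B [b Bb] [C1 oC1 B1] [C2 cC2 B2].
have cB : closed B by rewrite B2; exact: closedI.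
have [|N /set_nbhsP[V [oV BV VN]] clN] :=
    @compact_normal _ hT cT _ cB (~` (Q `\` C1)).
  apply/set_nbhsP; exists (~` (Q `\` C1)); split => //.
    by apply: closed_openC; apply: closedI => //; exact: open_closedC.
  by rewrite B1 => z [Qz C1z] [].
have oW : open (~` closure N) by exact/closed_openC/closed_closure.
have VW z : V z -> ~ (~` closure N) z by move=> Vz; apply; exact/subset_closure/VN.
have QVW : Q `<=` V `|` ~` closure N.
  move=> z Qz; have [C1z|nC1z] := pselect (C1 z).
    by left; apply: BV; rewrite B1.
  by right => /clN; apply.
have [z nz|D [[oD cD] Dx DVW]] := compact_clopen_sub cT (openU oV oW) (x := x).
  apply: contrapT => nD; apply: nz; apply: QVW => D cD Dx.
  by apply: contrapT => nDz; apply: nD; exists D.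
apply/seteqP; split; first by rewrite B1 => z [].
have cDV : clopen (D `&` V).
  split; first exact: openI.
  rewrite (_ : D `&` V = D `&` ~` ~` closure N).
    by apply: closedI => //; exact: open_closedC.
  apply/seteqP; split => z [Dz]; first by move/VW.
  by move=> nWz; split => //; have [|] := DVW z Dz.
have cDW : clopen (D `&` ~` closure N).
  split; first exact: openI.
  rewrite (_ : D `&` _ = D `&` ~` V).
    by apply: closedI => //; exact: open_closedC.
  apply/seteqP; split => z [Dz]; first by move=> Wz; split => // /VW.
  by move=> nVz; split => //; have [|] := DVW z Dz.
(* If [x] is in [V], then [Q] lies in [V], hence in [closure N], which misses [Q] outside [C1].
   Otherwise [Q] avoids [V], which contains [b]. *)
have [Vx|Wx] := DVW x Dx.
  move=> z Qz; rewrite B1; split => //; apply: contrapT => nC1z.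
  have [_ Vz] := Qz _ cDV (conj Dx Vx).
  by have := VN _ Vz => /subset_closure/clN; apply.
have : Q b by move: Bb; rewrite B1 => -[].
by move=> /(_ _ cDW (conj Dx Wx))[_ /(VW _ (BV _ Bb))].
Qed.

(** For y near x in [H], the element x^-1 y is near 1, hence in [H], and so is y = x (x^-1 y). *)
Lemma subgroup_open (G : topGroupType) (H : set G) :
  (forall x y, H x -> H y -> H (x * y)) -> nbhs (1 : G) H -> open H.
Proof.
move=> HM H1; rewrite openE => x Hx; rewrite /interior.
move: H1; rewrite -(mulVg x) => /(@mulgl_continuous G x^-1 x).
apply: (@filterS _ (nbhs x)) => y /= Hy.
by rewrite -[y](mulVKg x); exact: HM.
Qed.

(* The right stabilizer of a clopen neighborhood K of 1 is a subgroup         *)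
(* contained in K, and it is open because K and its complement are compact.   *)
Lemma open_subgroup_base (G : topGroupType) (A : set G) :
  profinite G -> nbhs (1 : G) A ->
  exists U : open_subgroup G, osg U `<=` A.
Proof.
move=> [cG hG tG] A1.
have zG := totally_disconnected_zero_dimensional cG hG tG.
have [K [K1 [oK cK]] KA] := zero_dimensional_cvg hG zG cG A1.
pose H := [set g | forall k, K k <-> K (k * g)].
have H1 : H 1 by move=> k; rewrite mulg1.
have HM x y : H x -> H y -> H (x * y).
  by move=> Hx Hy k; rewrite mulgA -(Hy (k * x)).
have HV x : H x -> H x^-1.
  by move=> Hx k; rewrite (Hx (k * x^-1)) mulgVK.
suff H1n : nbhs (1 : G) H.
  exists (OpenSubgroup (subgroup_open HM H1n) H1 HM HV) => g /= Hg.
  by apply: KA; rewrite -[g]mul1g -Hg.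
have muln (B : set G) (k : G) : open B -> B k ->
    \forall k' \near k & g \near (1 : G), B k' /\ B (k' * g).
  move=> oB Bk; have nB : nbhs k B by exact: open_nbhs_nbhs.
  apply: filterI; last by apply: (@mulg_continuous G (k, 1) B); rewrite /= mulg1.
  by exists (B, setT); [split => //; exact: filterT|move=> [k' g] []].
(* Compactness makes uniform in k the local statement that [K k] and [K (k * g)] agree for g near
   1. *)
have near_covG := (compact_near_coveringP _).1 cG.
apply: (@filterS _ _ _ [set g | [set: G] `<=` (fun k => K k <-> K (k * g))]).
  by move=> g Hg k; exact: Hg.
apply: near_covG => k _; have [Kk|nKk] := pselect (K k).
  by apply: filterS (muln K k oK Kk) => -[k' g] /= [].
by apply: filterS (muln (~` K) k (closed_openC cK) nKk) => -[k' g] /= [].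
Qed.

(** * Homomorphisms, the virtual center, and centralizers in Comm(G) *)

Section MultiplicativeGroup.
Variables (G H : groupType) (f : {multiplicative G -> H}).

Lemma multiplicative1 : f 1 = 1.
Proof.
have /(congr1 ( *%g (f 1)^-1)) := @gmulfM _ _ f 1 1.
by rewrite mulg1 mulKg mulVg.
Qed.

Lemma multiplicativeV x : f x^-1 = (f x)^-1.
Proof. by rewrite -[LHS](mulKg (f x)) -gmulfM mulgV multiplicative1 mulg1. Qed.

End MultiplicativeGroup.

Lemma commute_conjP (G : groupType) (l x : G) : commute l x <-> l * x * l^-1 = x.
Proof.
by split => [->|E]; rewrite ?mulgK// /commute -{2}E mulgVK.
Qed.

Lemma virtual_center_nbhs (G : topGroupType) (g : G) :
  nbhs (1 : G) [set x | commute g x] -> virtual_center G g.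
Proof. by apply: subgroup_open => x y; exact: commuteM. Qed.

(** If conjugations by x and y agree on an open subgroup, then y^-1 x centralizes it and so lies in
    the virtual center. *)
Lemma comm_iota_inj (G : topGroupType) (U : open_subgroup G) :
  virtual_center G = [set 1] -> injective (comm_iota U).
Proof.
move=> VZ x y /vclassE[W [_ _ E]].
suff : virtual_center G (y^-1 * x).
  by rewrite VZ => /(congr1 ( *%g y)); rewrite mulVKg mulg1.
apply: virtual_center_nbhs.
have nW : nbhs (1 : G) (osg W).
  by apply: open_nbhs_nbhs; split; [exact: osg_open|exact: osg1].
apply: (@filterS _ (nbhs (1 : G))) nW => w /E /= xyw; apply/commute_conjP.
have -> : y^-1 * x * w * (y^-1 * x)^-1 = y^-1 * (x * w * x^-1) * y.
  by rewrite invgM invgK !mulgA.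
by rewrite xyw !mulgA mulVg mul1g mulgVK.
Qed.

(** If c is the class of f, then c iota(x) c^-1 = iota(f x). Commutation thus gives iota(f x) =
    iota(x), and injectivity of iota makes f the identity near 1. *)
Lemma comm_centralizer (G : topGroupType) (U : open_subgroup G) (c : Comm G) :
  virtual_center G = [set 1] ->
  (forall g, U g -> c * comm_iota U g = comm_iota U g * c) -> c = 1.
Proof.
have [f ->] := vclassP c => VZ cU; rewrite -(comm_iota1 osgT); apply/vclassE.
exists (osgI U (vdom f)); split => // x [Ux fx] //=.
rewrite mul1g invg1 mulg1; apply: (comm_iota_inj (U := U) VZ).
by apply: (@mulIg _ (vclass f)); rewrite -comm_iota_conj// cU.
Qed.

(** * The homomorphism from the envelope to Comm(G) *)

Section EnvelopeConjugation.
Variables (G L : topGroupType) (eta : {multiplicative G -> L}) (eta' : L -> G).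
Hypotheses (open_eta : open (range eta)) (eta_cont : continuous eta).
Hypothesis etaK : cancel eta eta'.
Hypothesis eta'_cont : {within range eta, continuous eta'}.

Let etaV x : eta x^-1 = (eta x)^-1 := multiplicativeV eta x.

Lemma range_etaK l : range eta l -> eta (eta' l) = l.
Proof. by move=> [g _ <-]; rewrite etaK. Qed.

Lemma eta_open_map : open_map eta.
Proof.
move=> A oA; rewrite openE => _ [g Ag <-].
have rg : range eta (eta g) by exists g.
have := eta'_cont; rewrite continuous_open_subspace//.
move=> /(_ (eta g) (mem_set rg) A).
rewrite etaK => /(_ (open_nbhs_nbhs (conj oA Ag))) A'; have R := open_nbhs_nbhs (conj open_eta rg).
apply: (@filterS _ (nbhs (eta g))) (filterI R A') => l /= [rl Al].
by exists (eta' l) => //; exact: range_etaK.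
Qed.

Lemma range_conjM l x y : range eta (l * eta x * l^-1) ->
  range eta (l * eta y * l^-1) -> range eta (l * eta (x * y) * l^-1).
Proof.
move=> [a _ ea] [b _ eb]; exists (a * b) => //.
by rewrite !gmulfM ea eb !mulgA mulgVK.
Qed.

Lemma range_conjV l x : range eta (l * eta x * l^-1) ->
  range eta (l * eta x^-1 * l^-1).
Proof.
by move=> [a _ ea]; exists a^-1 => //; rewrite !etaV ea !invgM invgK mulgA.
Qed.

Lemma conj_eta_continuous l : continuous (fun x => l * eta x * l^-1).
Proof.
move=> x; apply: (@continuous_comp _ _ _ eta (fun m => l * m * l^-1)).
  exact: eta_cont.
exact: conj_continuous.
Qed.

(** With G identified with its image, this is the intersection of G and l^-1 G l. *)
Definition env_dom (l : L) : open_subgroup G.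
refine (@OpenSubgroup G (fun x => range eta (l * eta x * l^-1)) _ _
  (@range_conjM l) (@range_conjV l)).
  by apply: open_comp open_eta => x _; exact: conj_eta_continuous.
by exists 1 => //; rewrite multiplicative1 mulg1 mulgV.
Defined.

Definition env_fun (l : L) (x : G) := eta' (l * eta x * l^-1).

Lemma eta_env_fun l x : env_dom l x -> eta (env_fun l x) = l * eta x * l^-1.
Proof. exact: range_etaK. Qed.

Lemma eta_inj : injective eta. Proof. exact: can_inj etaK. Qed.

Lemma env_funP l x : env_dom l x -> env_dom l^-1 (env_fun l x).
Proof.
move=> lx; exists x => //.
by rewrite eta_env_fun// invgK -!mulgA mulVg mulg1 mulKg.
Qed.

Lemma env_funK l x : env_dom l x -> env_fun l^-1 (env_fun l x) = x.
Proof.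
move=> lx; apply: eta_inj; rewrite eta_env_fun; last exact: env_funP.
by rewrite eta_env_fun// invgK -!mulgA mulVg mulg1 mulKg.
Qed.

Lemma env_funM l x y : env_dom l x -> env_dom l y ->
  env_fun l (x * y) = env_fun l x * env_fun l y.
Proof.
move=> lx ly; apply: eta_inj; rewrite gmulfM !eta_env_fun//; last exact: osgM.
by rewrite gmulfM !mulgA mulgVK.
Qed.

Lemma env_fun_continuous l : {within osg (env_dom l), continuous (env_fun l)}.
Proof.
rewrite continuous_open_subspace; last exact: osg_open.
move=> x /set_mem lx.
apply: (@continuous_comp _ _ _ (fun x => l * eta x * l^-1) eta').
  exact: conj_eta_continuous.
by have := eta'_cont; rewrite continuous_open_subspace//; apply; exact: mem_set.
Qed.

(** The inverse is conjugation by l^-1, so its laws are those already proved, read at [l^-1]. *)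
Definition env_aut (l : L) : virtual_aut G.
refine (@VirtualAut G (env_dom l) (env_dom l^-1) (env_fun l) (env_fun l^-1)
  (@env_funP l) _ (@env_funK l) _ (@env_funM l)
  (@env_fun_continuous l) (@env_fun_continuous l^-1)) => y.
  by move=> ly; rewrite -{1}[l]invgK; exact: env_funP.
by move=> ly; rewrite -{1}[l]invgK; exact: env_funK.
Defined.

Definition env_class (l : L) : Comm G := vclass (env_aut l).

Lemma env_classM : {morph env_class : l m / l * m}.
Proof.
move=> l m; rewrite /env_class vclassM; apply/vclassE.
exists (vdom (vcomp (env_aut l) (env_aut m))).
have E x : vdom (vcomp (env_aut l) (env_aut m)) x ->
    l * eta (env_fun m x) * l^-1 = l * m * eta x * (l * m)^-1.
  by move=> [/= mx _]; rewrite eta_env_fun// invgM !mulgA.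
split => //; first by move=> x Wx; have [_] := Wx; rewrite /= E.
by move=> x Wx; rewrite /= /env_fun -E.
Qed.

HB.instance Definition _ :=
  isMultiplicative.Build L (Comm G) env_class env_classM.

Lemma env_class_eta g : env_class (eta g) = comm_iota osgT g.
Proof.
apply/vclassE; exists (env_dom (eta g)); split => // x _ /=.
by rewrite /env_fun -etaV -!gmulfM etaK.
Qed.

Lemma env_aut_conj l : envelope_conj eta l (env_aut l).
Proof.
split; [by []|by move=> y /=; rewrite invgK|].
exact: eta_env_fun.
Qed.

Lemma env_class_continuous : continuous env_class.
Proof.
move=> l A [U UA].
have o : open [set m | (eta @` osg U) (l^-1 * m)].
  apply: (@open_comp _ _ (fun m => l^-1 * m)).
    by move=> m _; exact: mulgl_continuous.
  by apply: eta_open_map; exact: osg_open.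
apply: (@filterS _ (nbhs l)) (open_nbhs_nbhs (conj o _)).
  move=> m [u Uu um]; rewrite -(mulVKg l m) -um /= env_classM env_class_eta.
  by rewrite (comm_iota_eq _ U); exact: UA.
by exists 1; [exact: osg1|rewrite multiplicative1 mulVg].
Qed.

(** Profiniteness provides an open subgroup U of G with l U inside the open set; the image of l U is
    a basic strong neighborhood of the class of l. *)
Lemma env_class_open : profinite G -> open_map env_class.
Proof.
move=> pG A oA; rewrite openE => _ [l Al <-].
have n1 : nbhs (1 : G) [set g | A (l * eta g)].
  apply: open_nbhs_nbhs; split; last by rewrite /= multiplicative1 mulg1.
  apply: (@open_comp _ _ (fun g => l * eta g)) oA => x _.
  apply: (@continuous_comp _ _ _ eta (fun m => l * m)); first exact: eta_cont.
  exact: mulgl_continuous.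
have [U UA] := open_subgroup_base pG n1.
exists U => g Ug; exists (l * eta g); first exact: UA.
by rewrite env_classM env_class_eta (comm_iota_eq _ U).
Qed.

Lemma env_class_ker : env_class @^-1` [set 1] = virtual_center L.
Proof.
apply/seteqP; split => l /=.
  rewrite -(comm_iota1 osgT) => /vclassE[W [Wl _ E]].
  apply: virtual_center_nbhs.
  have := eta_open_map (osg_open W).
  move=> oW; apply: (@filterS _ (nbhs (1 : L))) (open_nbhs_nbhs (conj oW _)).
    move=> _ [w Ww <-] /=; apply/commute_conjP.
    by rewrite -eta_env_fun; [rewrite [env_fun _ _]E//= mul1g invg1 mulg1|exact: Wl].
  by exists 1; [exact: osg1|rewrite multiplicative1].
(* Conversely, conjugation by l is the identity on the trace on G of the open centralizer of l. *)
move=> oC; rewrite -(comm_iota1 osgT).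
have oW : open [set x | commute l (eta x)]
  by apply: open_comp oC => x _; exact: eta_cont.
have W1 : [set x | commute l (eta x)] 1.
  by rewrite /= multiplicative1; exact: commute1.
have WM x y : commute l (eta x) -> commute l (eta y) -> commute l (eta (x * y)).
  by rewrite gmulfM; exact: commuteM.
have WV x : commute l (eta x) -> commute l (eta x^-1).
  by rewrite etaV; exact: commuteV.
apply/vclassE; exists (OpenSubgroup oW W1 WM WV).
split => // x /= /commute_conjP lx; first by rewrite lx; exists x.
by rewrite /env_fun lx etaK mul1g invg1 mulg1.
Qed.

Lemma env_class_unique (psi : {multiplicative L -> Comm G}) :
  virtual_center G = [set 1] ->
  (forall g, psi (eta g) = comm_iota osgT g) -> psi =1 env_class.
Proof.
move=> VZ psi_eta l.
pose c := (env_class l)^-1 * psi l.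
suff c1 : c = 1 by rewrite -[LHS](mulVKg (env_class l)) -/c c1 mulg1.
apply: (comm_centralizer (U := env_dom l) VZ) => x lx.
(* Any homomorphism extending iota carries this relation to Comm(G), so [psi l] and [env_class l]
   conjugate iota(x) alike and [c] commutes with it. *)
have E : l * eta x = eta (env_fun l x) * l by rewrite eta_env_fun// mulgVK.
have Epsi : psi l * comm_iota osgT x = comm_iota osgT (env_fun l x) * psi l.
  by rewrite -!psi_eta -!gmulfM E.
have Eenv : env_class l * comm_iota osgT x =
    comm_iota osgT (env_fun l x) * env_class l.
  by rewrite -!env_class_eta -!env_classM E.
rewrite (comm_iota_eq _ osgT) /c -mulgA Epsi !mulgA; congr (_ * _).
by apply: (@mulgI _ (env_class l)); rewrite !mulgA mulgV mul1g Eenv mulgK.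
Qed.

End EnvelopeConjugation.

Unset Implicit Arguments.

Theorem proposition3p3 (G L : topGroupType) (eta : {multiplicative G -> L}) :
  profinite G -> envelope eta ->
  exists etas : {multiplicative L -> Comm G},
    [/\ continuous etas /\ open_map etas,
        forall g : G, etas (eta g) = comm_iota osgT g,
        forall l : L, exists2 f : virtual_aut G,
          envelope_conj eta l f & etas l = vclass f,
        etas @^-1` [set 1] = virtual_center L
      & virtual_center G = [set 1] ->
        forall psi : {multiplicative L -> Comm G},
          (forall g : G, psi (eta g) = comm_iota osgT g) -> psi =1 etas].
Proof.
move=> pG [_ oeta ceta [eta' etaK ceta']].
exists (env_class oeta ceta etaK ceta'); split.
- by split; [exact: env_class_continuous|exact: env_class_open].
- exact: env_class_eta.
- by move=> l; exists (env_aut oeta ceta etaK ceta' l) => //; exact: env_aut_conj.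
- exact: env_class_ker.
- by move=> VZ psi; exact: env_class_unique.
Qed.
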